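(* Let $M$ be a closed surface and let $f\in\mathrm{End}^1(M)$ be an endomorphism having full-dimensional kernel. Then $f$ is not robustly transitive.
   Context: A closed surface $M$ is a compact connected smooth 2-manifold without boundary. $\mathrm{End}^1(M)$ is the space of all $C^1$ maps $M\to M$ with the $C^1$ topology; its elements are called endomorphisms. $\mathrm{Cr}(f)=\{x\in M: Df_x\text{ is not an isomorphism}\}$. $f$ has full-dimensional kernel if there exist an integer $n\ge1$ and $x\in\mathrm{Cr}(f)$ such that $\dim\ker(Df^n_x)=\dim M=2$. A map is transitive if some point has a forward orbit dense in $M$. $f$ is robustly transitive if there is a neighborhood $\mathcal U$ of $f$ in $\mathrm{End}^1(M)$ such that every $g\in\mathcal U$ is transitive. *)

(* Defs.v *)
From HB Require Import structures.
From mathcomp Require Import all_boot all_order all_algebra.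
From mathcomp Require Import all_classical all_reals all_analysis.

Set Implicit Arguments.
Unset Strict Implicit.
Unset Printing Implicit Defensive.

Import Order.TTheory GRing.Theory Num.Theory.
Import numFieldNormedType.Exports.

Local Open Scope classical_set_scope.
Local Open Scope ring_scope.

(* C^k regularity of a map between planar open sets, the map being given as a
   total function; only its values on the open set U matter. *)
Fixpoint Ck_on (R : realType) (k : nat) (U : set 'rV[R]_2)
    (g : 'rV[R]_2 -> 'rV[R]_2) : Prop :=
  match k with
  | 0 => forall p, U p -> {for p, continuous g}
  | k'.+1 => (forall p, U p -> differentiable g p) /\
             forall v, Ck_on k' U ('D_v g)
  end.

Definition smooth_on (R : realType) (U : set 'rV[R]_2)
    (g : 'rV[R]_2 -> 'rV[R]_2) : Prop := forall k, Ck_on k U g.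

(* A homeomorphism from an open subset of M onto an open subset of the plane.
   Both directions are total functions, with irrelevant values outside
   chart_dom and its image respectively. *)
Record chart (R : realType) (M : topologicalType) := Chart {
  chart_dom : set M;
  chart_map :> M -> 'rV[R]_2;
  chart_inv : 'rV[R]_2 -> M;
  chart_dom_open : open chart_dom;
  chart_img_open : open (chart_map @` chart_dom);
  chart_mapK : forall x, chart_dom x -> chart_inv (chart_map x) = x;
  chart_map_continuous :
    forall x, chart_dom x -> {for x, continuous chart_map};
  chart_inv_continuous :
    forall p, (chart_map @` chart_dom) p -> {for p, continuous chart_inv}
}.

(* The smooth structure is given by a smooth atlas, not assumed maximal,
   together with a preferred chart around each point, used only to fix
   coordinates on tangent spaces. Second countability is automatic from
   compactness. *)
Record closedSurface (R : realType) := ClosedSurface {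
  surface_carrier :> topologicalType;
  surface_atlas : set (chart R surface_carrier);
  chart_at : surface_carrier -> chart R surface_carrier;
  chart_at_atlas : forall x, surface_atlas (chart_at x);
  chart_at_dom : forall x, chart_dom (chart_at x) x;
  transition_smooth : forall c d, surface_atlas c -> surface_atlas d ->
    smooth_on (c @` (chart_dom c `&` chart_dom d)) (d \o chart_inv c);
  surface_hausdorff : hausdorff_space surface_carrier;
  surface_compact : compact [set: surface_carrier];
  surface_connected : connected [set: surface_carrier]
}.

Section Endomorphisms.
Context {R : realType} (M : closedSurface R).

Definition local_rep (c d : chart R M) (f : M -> M) : 'rV[R]_2 -> 'rV[R]_2 :=
  d \o f \o chart_inv c.

Definition C1_map (f : M -> M) : Prop :=
  continuous f /\
  forall c d, surface_atlas c -> surface_atlas d ->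
    Ck_on 1 (c @` (chart_dom c `&` f @^-1` chart_dom d)) (local_rep c d f).

Record End1 := MkEnd1 { end_map :> M -> M; end_C1 : C1_map end_map }.

HB.instance Definition _ := gen_eqMixin End1.
HB.instance Definition _ := gen_choiceMixin End1.

(* The maps that are e-close to f, together with their first derivatives, on
   the compact set K read in the charts c (source) and d (target). *)
Definition C1_ball (f : End1) (c d : chart R M) (K : set M) (e : R)
    : set End1 :=
  [set g : End1 | g @` K `<=` chart_dom d /\
    forall x, K x ->
      `|local_rep c d g (c x) - local_rep c d f (c x)| < e /\
      `|'J (local_rep c d g) (c x) - 'J (local_rep c d f) (c x)| < e].

Definition C1_subbase : set (set End1) :=
  [set N | exists (f : End1) (c d : chart R M) (K : set M) (e : R),
    [/\ surface_atlas c /\ surface_atlas d,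
        compact K /\ K `<=` chart_dom c,
        f @` K `<=` chart_dom d, 0 < e & N = C1_ball f c d K e]].

(* The C^1 compact-open topology (weak and strong versions agree since M is
   compact). *)
HB.instance Definition _ := isSubBaseTopological.Build End1 C1_subbase id.

(* Df_x : T_x M -> T_(f x) M, with T_x M identified with the plane through
   the preferred chart at x. *)
Definition tangent_map (f : M -> M) (x : M) : 'rV[R]_2 -> 'rV[R]_2 :=
  'd (local_rep (chart_at x) (chart_at (f x)) f) (chart_at x x).

Definition Cr (f : M -> M) : set M := [set x | ~ bijective (tangent_map f x)].

Definition full_dimensional_kernel (f : M -> M) : Prop :=
  exists (n : nat) (x : M), [/\ (1 <= n)%N, Cr f x &
    \dim (lker (linfun (tangent_map (iter n f) x))) = 2%N].

Definition transitive_map (f : M -> M) : Prop :=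
  exists x : M, dense [set iter n f x | n in [set: nat]].

Definition robustly_transitive (f : End1) : Prop :=
  exists2 U : set End1, nbhs f U & forall g, U g -> transitive_map g.

End Endomorphisms.

(* Main.v *)
From HB Require Import structures.
Require Import Defs.
From mathcomp Require Import all_boot all_order all_algebra.
From mathcomp Require Import all_classical all_reals all_analysis.
From mathcomp Require Import ring lra.

Set Implicit Arguments.
Unset Strict Implicit.
Unset Printing Implicit Defensive.

Import Order.TTheory GRing.Theory Num.Theory.
Import numFieldNormedType.Exports.

Local Open Scope classical_set_scope.
Local Open Scope ring_scope.

(** Let [Df^n] vanish at [x].  The idea is to perturb [f], arbitrarily little in
the C1 topology, so that some iterate becomes constant on an open set; such a map
has no dense orbit ([const_iter_not_transitive]).

Near each point [p] of the orbit segment [x], [f x], ..., [f^(n-1) x], replace [f],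
read in the preferred charts at [p] and [f p], by its affine approximation at [p].
The perturbed map [g] follows the same orbit segment, and near [x] the iterate [g^n]
is the composition of these affine maps.  By the chain rule its linear part is
[Df^n] at [x], that is 0, so [g^n] is constant near [x] ([iter_affine]).  Since the
affine approximation depends on the point only, repetitions in the orbit segment do
no harm: the distinct points are treated one after the other ([linearize_along]).

It remains to see that the replacement is C1-small.  In the plane, put
[h_r z = L z + cutoff ((z - q) / r) (h z - L z)], where [L] is the affine
approximation of [h] at [q] and the cutoff goes from 0 to 1 between the balls of
radius 1 and 2.  The derivative of the cutoff term is of order [1 / r], but
[h - L] is [o(r)] there, so all 1-jets of [h_r] over the ball of radius [2 * r] tend
to the 1-jet of [h] at [q] as [r] tends to 0 ([blend_cvg]).  A subbasic
neighbourhood of [f] for the C1 topology is given by strict inequalities on 1-jets,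
possibly in other charts and with another map as centre; as these inequalities are
open and [h_r] differs from [h] only near [q], it is enough that they hold for [f]
at [p] ([near_flatten_ball]), and the perturbed maps converge to [f]
([flatten_end_cvg]). *)

(** * Differentials and Jacobians in the plane *)

(** The Jacobian is locked: unification that compares two unlocked Jacobians
unfolds the choice operator defining the differential and does not return. *)
HB.lock Definition Jac (R : numFieldType) n m (f : 'rV[R]_n -> 'rV[R]_m) a :=
  'J f a.

Section Calculus.
Context {R : realType}.

Lemma near_eq_diff (V W : normedModType R) (f g : V -> W) (a : V) :
  {near a, f =1 g} -> differentiable f a ->
  differentiable g a /\ 'd g a = 'd f a :> (V -> W).
Proof.
move=> fg df; have /diff_locallyP[cf ef] := df.
have eg : g \o shift a = cst (g a) + 'd f a +o_0 id.
  apply/eqaddoP => e e0; move/eqaddoP: ef => /(_ e e0).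
  have ga : g a = f a by rewrite (nbhs_singleton fg).
  have : \forall z \near (0 : V), f (shift a z) = g (shift a z).
    by move: fg; rewrite (near_shift 0 a)/= subr0.
  by move=> F1; apply: filterS2 F1 => z fgz; rewrite !fctE /= ga -fgz.
have dg : 'd g a = 'd f a :> (V -> W) by exact: diff_unique.
have ed : g \o shift a = cst (g a) + 'd g a +o_0 id by rewrite dg.
have cd : continuous ('d g a) by rewrite dg.
by have D := (proj2 (diff_locallyP a g)) (conj cd ed).
Qed.

Lemma rV_mulmx_inj n m (A B : 'M[R]_(n, m)) :
  (forall v : 'rV_n, v *m A = v *m B) -> A = B.
Proof. by move=> AB; apply/row_matrixP => i; rewrite !rowE. Qed.

Lemma diffE_Jac n m (f : 'rV[R]_n -> 'rV[R]_m) a v :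
  'd f a v = v *m Jac f a.
Proof. by rewrite Jac.unlock /jacobian mul_rV_lin1. Qed.

Lemma near_eq_Jac n m (f g : 'rV[R]_n -> 'rV[R]_m) a :
  {near a, f =1 g} -> differentiable f a -> Jac g a = Jac f a.
Proof.
move=> fg df; have [_ dgE] := near_eq_diff fg df.
apply: rV_mulmx_inj => v; apply: etrans (esym (diffE_Jac g a v)) _.
apply: etrans _ (diffE_Jac f a v).
exact: (congr1 (fun F => F v) dgE).
Qed.

Lemma Jac_comp n m k (f : 'rV[R]_n -> 'rV[R]_m) (g : 'rV[R]_m -> 'rV[R]_k) a :
  differentiable f a -> differentiable g (f a) ->
  Jac (g \o f) a = Jac f a *m Jac g (f a).
Proof.
move=> df dg; apply: rV_mulmx_inj => v; rewrite mulmxA.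
apply: etrans (esym (diffE_Jac (g \o f) a v)) _.
apply: etrans (congr1 (fun F => F v) (diff_comp df dg)) _.
by rewrite -(diffE_Jac f a v); exact: diffE_Jac.
Qed.

Lemma derive_Jac n m (f : 'rV[R]_n -> 'rV[R]_m) a v :
  differentiable f a -> 'D_v f a = v *m Jac f a.
Proof. by move=> df; rewrite Jac.unlock deriveEjacobian. Qed.

Lemma norm_mx_le n m (A : 'M[R]_(n, m)) e : 0 <= e ->
  (forall i j, `|A i j| <= e) -> `|A| <= e.
Proof.
move=> e0 Ae; rewrite [leLHS]/Num.Def.normr/= mx_normrE bigmax_le// => i _.
Qed.

Lemma coord_le_norm n m (A : 'M[R]_(n, m)) i j : `|A i j| <= `|A|.
Proof.
rewrite [leRHS]/Num.Def.normr/= mx_normrE.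
exact: (le_bigmax _ (fun ij => `|A ij.1 ij.2|) (i, j)).
Qed.

Lemma cvg_mxP (T : Type) (F : set_system T) {FF : Filter F} n m
    (f : T -> 'M[R]_(n, m)) (A : 'M[R]_(n, m)) :
  (f @ F --> A) <-> (forall i j, (fun t => f t i j) @ F --> A i j).
Proof.
split=> [fA i j|fA].
  exact: (cvg_comp _ _ fA (@coord_continuous _ _ _ i j A)).
apply/cvgrPdist_le => /= e e0; near=> x.
rewrite /Num.Def.normr/= mx_normrE (bigmax_le _ (ltW e0))//= => i _.
rewrite !mxE; move: i; near: x; apply: filter_forall => /= i.
exact: ((cvgrPdist_le _ _).1 (fA i.1 i.2)).
Unshelve. all: by end_near. Qed.

Lemma cvg_mulmx (T : Type) (F : set_system T) {FF : Filter F} n m k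
    (f : T -> 'M[R]_(n, m)) (g : T -> 'M[R]_(m, k))
    (A : 'M[R]_(n, m)) (B : 'M[R]_(m, k)) :
  f @ F --> A -> g @ F --> B -> (fun t => f t *m g t) @ F --> A *m B.
Proof.
move=> /cvg_mxP fA /cvg_mxP gB; apply/cvg_mxP => i j.
rewrite mxE; under eq_fun do rewrite mxE.
by apply: cvg_big => [|l _]; [exact: add_continuous|apply: cvgM; [exact: fA|exact: gB]].
Qed.

(** Being C1, as a property of the germ of [h] at [q]: differentiability near
[q], but continuity of the Jacobian only at [q].  Asking for it at every point
of an open set is [Ck_on 1] (see [Ck_on1P]), and unlike [Ck_on] it can be
checked locally and in any pair of charts. *)
Definition C1_near (h : 'rV[R]_2 -> 'rV[R]_2) (q : 'rV[R]_2) :=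
  (\forall z \near q, differentiable h z) /\ (Jac h @ q --> Jac h q).

Lemma C1_near_differentiable h q : C1_near h q -> differentiable h q.
Proof. by move=> [/nbhs_singleton]. Qed.

Lemma C1_near_continuous h q : C1_near h q -> {for q, continuous h}.
Proof. by move=> /C1_near_differentiable /differentiable_continuous. Qed.

Lemma near_eq_C1_near g h q : {near q, h =1 g} -> C1_near h q -> C1_near g q.
Proof.
move=> hg [dh Jh].
have ne : \forall z \near q, differentiable g z /\ Jac g z = Jac h z.
  have hgn : \forall z \near q, {near z, h =1 g} by exact/nbhs_interior.
  near=> z; have dhz : differentiable h z by near: z.
  have hgz : {near z, h =1 g} by near: z.
  by split; [case: (near_eq_diff hgz dhz)|exact: near_eq_Jac].
split; first by apply: filterS ne => z [].
rewrite (nbhs_singleton ne).2.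
have E : {near q, Jac h =1 Jac g} by apply: filterS ne => z [].
exact: cvg_trans (near_eq_cvg E) Jh.
Unshelve. all: by end_near. Qed.

Lemma C1_near_comp g h q : C1_near h q -> C1_near g (h q) -> C1_near (g \o h) q.
Proof.
move=> Ch Cg; have ch := C1_near_continuous Ch.
have dgn : \forall z \near q, differentiable g (h z) by exact: ch Cg.1.
split.
  near=> z; apply: differentiable_comp; first by near: z; exact: Ch.1.
  by near: z.
rewrite /prop_for /continuous_at.
rewrite Jac_comp; [|exact: C1_near_differentiable..].
have C : (fun z => Jac h z *m Jac g (h z)) @ q --> Jac h q *m Jac g (h q).
  by have C := cvg_mulmx Ch.2 (cvg_comp _ _ ch Cg.2); exact: C.
have E : {near q, (fun z => Jac h z *m Jac g (h z)) =1 Jac (g \o h)}.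
  by near=> z; rewrite Jac_comp //; near: z; [exact: Ch.1|exact: dgn].
exact: cvg_trans (near_eq_cvg E) C.
Unshelve. all: by end_near. Qed.

Lemma C1_nearP h q : C1_near h q <->
  (\forall z \near q, differentiable h z) /\ forall v, {for q, continuous ('D_v h)}.
Proof.
split=> -[dh Dh]; split=> //; have dq : differentiable h q := nbhs_singleton dh.
  move=> v; rewrite /prop_for /continuous_at derive_Jac//.
  have C := cvg_mulmx (cvg_cst v) Dh.
  have E : {near q, (fun z => v *m Jac h z) =1 'D_v h}.
    by near=> z; rewrite derive_Jac//; near: z.
  exact: cvg_trans (near_eq_cvg E) (C _ _).
have JE i j z : differentiable h z -> 'D_(delta_mx 0 i) h z 0 j = Jac h z i j.
  by move=> d; rewrite derive_Jac // -rowE mxE.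
apply: (@cvg_mxP _ (nbhs q) _ _ _ _ _).2 => i j.
have C := (@cvg_mxP _ (nbhs q) _ _ _ _ _).1 (Dh (delta_mx 0 i)) 0 j.
rewrite -JE//.
have E : {near q, (fun z => 'D_(delta_mx 0 i) h z 0 j) =1 (fun z => Jac h z i j)}.
  by near=> z; rewrite JE//; near: z.
exact: cvg_trans (near_eq_cvg E) (C _).
Unshelve. all: by end_near. Qed.

Lemma Ck_on1P (U : set 'rV[R]_2) h : open U ->
  Ck_on 1 U h <-> forall q, U q -> C1_near h q.
Proof.
move=> oU; split=> [[dh Dh] q Uq|Ch].
  apply/C1_nearP; split=> [|v]; last exact: Dh.
  by apply: filterS (open_nbhs_nbhs (conj oU Uq)).
split=> [q Uq|v q Uq]; first exact/C1_near_differentiable/Ch.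
by have /C1_nearP[_] := Ch q Uq; exact.
Qed.

End Calculus.

(** * A C1 cutoff function *)

Section ScaleDiff.
Context {R : realType} {V W : normedModType R}.

Lemma scale_is_bilinear :
  bilinear_for
    (GRing.Scale.Law.clone _ _ *:%R _) (GRing.Scale.Law.clone _ _ *:%R _)
    (fun (a : R) (w : W) => a *: w).
Proof.
split=> [u'|u] a x y /=; first by rewrite scalerDl scalerA.
by rewrite scalerDr !scalerA mulrC.
Qed.

Lemma is_diff_scale (k dk : V -> R) (f df : V -> W) x :
  is_diff x k dk -> is_diff x f df ->
  is_diff x (fun z => k z *: f z) (fun v => k x *: df v + dk v *: f x).
Proof.
move=> dkx dfx.
pose sM := bilinear_isBilinear.Build R R W W _ _ _ scale_is_bilinear.
pose sB : {bilinear R -> W -> W} := HB.pack (fun (a : R) (w : W) => a *: w) sM.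
have cB : continuous (fun p : R * W => sB p.1 p.2) by exact: scale_continuous.
have dB (p : R * W) : is_diff p (fun q => sB q.1 q.2)
    (fun q => sB p.1 q.2 + sB q.1 p.2).
  by apply: DiffDef; [exact: differentiable_bilin|exact: diff_bilin].
have -> : (fun z => k z *: f z) = (fun q => sB q.1 q.2) \o (fun z => (k z, f z)).
  by [].
exact: is_diff_eq.
Qed.

Lemma is_diff_continuous (f df : V -> W) x : is_diff x f df -> f @ x --> f x.
Proof. by move=> d; apply: differentiable_continuous; exact: ex_diff. Qed.

End ScaleDiff.

Section Bump.
Context {R : realType}.

Definition sqpos (t : R) := Num.max 0 t ^+ 2.

Definition dsqpos (t : R) := 2 * Num.max 0 t.

(** The remainder is quadratic uniformly in [t], which gives differentiability
at the corner 0 and elsewhere by one argument. *)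
Lemma sqpos_taylor t h : `|sqpos (t + h) - sqpos t - dsqpos t * h| <= h ^+ 2.
Proof.
rewrite /sqpos /dsqpos ler_norml.
have [t0|t0] := ltP 0 t; have [th0|th0] := ltP 0 (t + h); apply/andP; split; nra.
Qed.

Lemma is_diff_sqpos (t : R) : is_diff t sqpos ( *:%R^~ (dsqpos t)).
Proof.
have dt : is_derive t 1 sqpos (dsqpos t).
  have C : h^-1 *: (sqpos (h *: 1 + t) - sqpos t) @[h --> 0^'] --> dsqpos t.
    apply/cvgrPdist_le => e e0; near=> h.
    have h0 : h != 0 by near: h; exact: nbhs_dnbhs_neq.
    have he : `|h| < e by near: h; exact: dnbhs0_lt.
    apply: le_trans (ltW he).
    have -> : dsqpos t - h^-1 *: (sqpos (h *: 1 + t) - sqpos t) =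
        - (h^-1 * (sqpos (t + h) - sqpos t - dsqpos t * h)).
      by rewrite [h *: 1]mulr1 [h + t]addrC /GRing.scale/=; field.
    rewrite normrN normrM normfV ler_pdivrMl ?normr_gt0// -expr2 real_normK ?num_real//.
    exact: sqpos_taylor.
  by apply: DeriveDef; [apply/cvg_ex; exists (dsqpos t)|exact: cvg_lim].
have d1 : derivable sqpos t 1 by exact: ex_derive.
apply: DiffDef; first exact/derivable1_diffP.
by rewrite deriv1E // derive1E derive_val.
Unshelve. all: by end_near. Qed.

(** Since [sqpos] vanishes on negative numbers and is at least 1 beyond 1,
composing it with itself through [1 - _] gives a C1 step that is exactly 0 before 0
and exactly 1 after 1, with no partition into cases. *)
Definition ramp (t : R) := 1 - sqpos (1 - sqpos t).

Definition dramp (t : R) := dsqpos (1 - sqpos t) * dsqpos t.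

Lemma ramp_ge0 t : 0 <= ramp t.
Proof.
rewrite /ramp /sqpos; have [t0|t0] := ltP 0 t; have [] := ltP 0 (1 - _); nra.
Qed.

Lemma ramp_le1 t : ramp t <= 1.
Proof. by rewrite /ramp lerBlDr lerDl /sqpos sqr_ge0. Qed.

Lemma ramp0 t : t <= 0 -> ramp t = 0.
Proof.
move=> t0; rewrite /ramp /sqpos (max_idPl t0) expr0n subr0.
by rewrite (max_idPr _) ?ler01// expr1n subrr.
Qed.

Lemma ramp1 t : 1 <= t -> ramp t = 1.
Proof.
move=> t1; rewrite /ramp /sqpos (max_idPr (le_trans ler01 t1)).
by rewrite (max_idPl _) ?expr0n ?subr0// subr_le0 exprn_ege1.
Qed.

Lemma dramp_bound t : `|dramp t| <= 4.
Proof.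
rewrite /dramp /dsqpos /sqpos ler_norml.
have [t0|t0] := ltP 0 t; have [s0|s0] := ltP 0 (1 - _); apply/andP; split; nra.
Qed.

Lemma is_diff_ramp (t : R) : is_diff t ramp ( *:%R^~ (dramp t)).
Proof.
have d1 := is_diff_sqpos t; have d2 := is_diff_sqpos (1 - sqpos t).
have -> : ramp = cst 1 - sqpos \o (cst 1 - sqpos) by [].
apply: is_diff_eq; rewrite funeqE => u; rewrite /dramp /= !fctE /=.
by rewrite !sub0r /GRing.scale/=; ring.
Qed.

End Bump.

Section Cutoff.
Context {R : realType}.
Implicit Types w u : 'rV[R]_2.

Lemma norm_coord w : exists i, `|w| = `|w 0 i|.
Proof.
have [->|w0] := eqVneq w 0; first by exists 0; rewrite mxE !normr0.
have /mx_norm_neq0[[i j]] : mx_norm w != 0.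
  by apply: contra_neq w0; exact: mx_norm_eq0.
by rewrite ord1 => wj; exists j.
Qed.

(** The norm on the plane is the sup norm, hence the constant 2: the sum of squares
is at most 2 on the unit ball and at least 4, which exceeds 2 + 1, outside the ball of
radius 2. *)
Definition radial w := w 0 0 ^+ 2 + w 0 1 ^+ 2 - 2.

Definition cutoff w := ramp (radial w).

Definition dcutoff w u :=
  dramp (radial w) * (2 * w 0 0 * u 0 0 + 2 * w 0 1 * u 0 1).

Lemma cutoff_in w : `|w| <= 1 -> cutoff w = 0.
Proof.
move=> w1; apply: ramp0; rewrite /radial.
have := le_trans (coord_le_norm w 0 0) w1; have := le_trans (coord_le_norm w 0 1) w1.
by rewrite !ler_norml => /andP[? ?] /andP[? ?]; nra.
Qed.

Lemma cutoff_out w : 2 <= `|w| -> cutoff w = 1.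
Proof.
have [i ->] := norm_coord w => wi; apply: ramp1; rewrite /radial.
have wi2 : 4 <= w 0 i ^+ 2 by rewrite -real_normK ?num_real//; nra.
have [i0|i1] : i = 0 \/ i = 1 by case: i {wi wi2} => [[|[|//]] ?]; [left|right]; exact/val_inj.
  by move: wi2; rewrite i0; have := sqr_ge0 (w 0 1); lra.
by move: wi2; rewrite i1; have := sqr_ge0 (w 0 0); lra.
Qed.

Lemma cutoff_ge0 w : 0 <= cutoff w. Proof. exact: ramp_ge0. Qed.

Lemma cutoff_le1 w : cutoff w <= 1. Proof. exact: ramp_le1. Qed.

Lemma dcutoff_bound w u : `|w| <= 2 -> `|dcutoff w u| <= 32 * `|u|.
Proof.
move=> w2; rewrite /dcutoff normrM.
have B i : `|2 * w 0 i * u 0 i| <= 4 * `|u|.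
  rewrite !normrM ger0_norm//; apply: ler_pM => //.
    by have := le_trans (coord_le_norm w 0 i) w2; lra.
  exact: coord_le_norm.
have -> : 32 * `|u| = 4 * (8 * `|u|) by ring.
apply: ler_pM => //; first exact: dramp_bound.
by apply: le_trans (ler_normD _ _) _; have := B 0; have := B 1; lra.
Qed.

Lemma is_diff_coord w i : is_diff w (fun z : 'rV[R]_2 => z 0 i) (fun u : 'rV[R]_2 => u 0 i).
Proof.
have @f : {linear 'rV[R]_2 -> R}.
  by exists (fun N : 'rV[R]_2 => N 0 i); do 2![eexists]; do ?[constructor];
     rewrite ?mxE// => ? *; rewrite ?mxE//; move=> ?; rewrite !mxE.
rewrite (_ : (fun _ => _) = f) //; apply: DiffDef.
  exact/linear_differentiable/coord_continuous.
exact/diff_lin/coord_continuous.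
Qed.

Lemma is_diff_radial w :
  is_diff w radial (fun u => 2 * w 0 0 * u 0 0 + 2 * w 0 1 * u 0 1).
Proof.
have d0 := is_diff_coord w 0; have d1 := is_diff_coord w 1.
have -> : radial = (fun z => z 0 0) ^+ 2 + (fun z => z 0 1) ^+ 2 - cst 2.
  by rewrite funeqE => z; rewrite /radial !fctE.
apply: is_diff_eq; rewrite funeqE => u.
transitivity (w 0 0 * u 0 0 + w 0 0 * u 0 0 +
  (w 0 1 * u 0 1 + w 0 1 * u 0 1) - (0 + 0)); [by []|ring].
Qed.

Lemma is_diff_cutoff w : is_diff w cutoff (dcutoff w).
Proof.
have dN := is_diff_radial w; have dr := is_diff_ramp (radial w).
have -> : cutoff = ramp \o radial by [].
apply: is_diff_eq; rewrite funeqE => u.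
by rewrite /dcutoff /= /GRing.scale /= mulrC.
Qed.

Lemma dsqpos_continuous : continuous (@dsqpos R).
Proof.
move=> t; have C := cvgM (cvg_cst (2 : R)) (continuous_max (cvg_cst (0 : R)) (@cvg_id _ (nbhs t))).
exact: C.
Qed.

Lemma dramp_continuous : continuous (@dramp R).
Proof.
move=> t; have sC := cvgB (cvg_cst (1 : R)) (is_diff_continuous (is_diff_sqpos t)).
have C := cvgM (cvg_comp _ _ (sC _ _) (@dsqpos_continuous _)) (@dsqpos_continuous t).
exact: C.
Qed.

Lemma dcutoff_continuous u : continuous (dcutoff^~ u).
Proof.
move=> w; have C i : (fun z : 'rV[R]_2 => 2 * z 0 i * u 0 i) @ w --> 2 * w 0 i * u 0 i.
  have C := cvgM (cvgM (cvg_cst (2 : R)) (@coord_continuous _ _ _ 0 i w)) (cvg_cst (u 0 i)).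
  exact: C.
have Cr := cvg_comp _ _ (is_diff_continuous (is_diff_radial w)) (@dramp_continuous _).
have D := cvgM Cr (cvgD (C 0) (C 1)); exact: D.
Qed.

End Cutoff.

(** * Replacing a planar map by its tangent map near a point *)

Section Blend.
Context {R : realType}.
Implicit Types (h : 'rV[R]_2 -> 'rV[R]_2) (q z v : 'rV[R]_2).

Lemma is_diff_mulmxr n m k (A : 'M[R]_(m, k)) (z : 'M[R]_(n, m)) :
  is_diff z (mulmxr A) (mulmxr A).
Proof.
have cA : continuous (mulmxr A : 'M[R]_(n, m) -> 'M[R]_(n, k)).
  by move=> x; have C := cvg_mulmx (@cvg_id _ (nbhs x)) (cvg_cst A); exact: C.
by apply: DiffDef; [exact: linear_differentiable|exact: diff_lin].
Qed.

Definition tangent_model h q z := h q + (z - q) *m Jac h q.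

Lemma is_diff_tangent_model h q z :
  is_diff z (tangent_model h q) (mulmxr (Jac h q)).
Proof.
have -> : tangent_model h q = cst (h q) + (mulmxr (Jac h q) \o (id - cst q)).
  by [].
have dm := @is_diff_mulmxr _ _ _ (Jac h q) ((id - cst q : _ -> _) z).
have D := is_diffD (is_diff_cst (h q) z)
  (is_diff_comp (is_diffB (is_diff_id z) (is_diff_cst q z)) dm).
by apply: (is_diff_eq D); rewrite funeqE => v; rewrite !fctE /= subr0 add0r.
Qed.

(** The tangent model on the ball of radius [r], the map [h] outside the ball of
radius [2 * r]. *)
Definition blend h q (r : R) z :=
  tangent_model h q z +
  cutoff (r^-1 *: (z - q)) *: (h z - tangent_model h q z).

Definition dblend h q (r : R) z v :=
  v *m Jac h q +
  (cutoff (r^-1 *: (z - q)) *: (v *m Jac h z - v *m Jac h q) +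
   (r^-1 * dcutoff (r^-1 *: (z - q)) v) *: (h z - tangent_model h q z)).

Lemma is_diff_scaled_cutoff q (r : R) z :
  is_diff z (fun z' => cutoff (r^-1 *: (z' - q)))
    (fun v => r^-1 * dcutoff (r^-1 *: (z - q)) v).
Proof.
have -> : (fun z' => cutoff (r^-1 *: (z' - q))) =
  cutoff \o (r^-1 \*: (id - cst q)) by [].
have dc := is_diff_cutoff ((r^-1 \*: (id - cst q) : _ -> _) z).
have D := is_diff_comp
  (is_diffZ r^-1 (is_diffB (is_diff_id z) (is_diff_cst q z))) dc.
apply: (is_diff_eq D); rewrite funeqE => v.
by rewrite /dcutoff !fctE /= !subr0 !mxE; ring.
Qed.

Lemma is_diff_blend h q (r : R) z :
  differentiable h z -> is_diff z (blend h q r) (dblend h q r z).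
Proof.
move=> /differentiableP dh; have dt := is_diff_tangent_model h q z.
have ds := is_diff_scale (is_diff_scaled_cutoff q r z) (is_diffB dh dt).
apply: (is_diff_eq (is_diffD dt ds)); rewrite funeqE => v; rewrite /dblend !fctE /=.
by rewrite (diffE_Jac h z v).
Qed.

Lemma blend_in h q (r : R) z : 0 < r -> `|z - q| <= r ->
  blend h q r z = tangent_model h q z.
Proof.
move=> r0 zr; rewrite /blend cutoff_in ?scale0r ?addr0//.
by rewrite normrZ gtr0_norm ?invr_gt0// ler_pdivrMl// mulr1.
Qed.

Lemma blend_out h q (r : R) z : 0 < r -> 2 * r <= `|z - q| ->
  blend h q r z = h z.
Proof.
move=> r0 zr; rewrite /blend cutoff_out; first by rewrite scale1r addrC subrK.
by rewrite normrZ gtr0_norm ?invr_gt0// ler_pdivlMl// mulrC.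
Qed.

Lemma C1_near_blend h q (r : R) z : C1_near h z -> C1_near (blend h q r) z.
Proof.
move=> Ch; apply/C1_nearP; split.
  by apply: filterS Ch.1 => y /(is_diff_blend q r) db; exact: ex_diff.
move=> v.
have E : {near z, (fun y => dblend h q r y v) =1 'D_v (blend h q r)}.
  apply: filterS Ch.1 => y /(is_diff_blend q r) db.
  by rewrite deriveE ?diff_val//; exact: ex_diff.
have ch := C1_near_continuous Ch.
have ct := is_diff_continuous (is_diff_tangent_model h q z).
have cc := is_diff_continuous (is_diff_scaled_cutoff q r z).
have cw : (fun y => r^-1 *: (y - q)) @ z --> r^-1 *: (z - q).
  have C := cvgZ (cvg_cst (r^-1 : R)) (cvgB (@cvg_id _ (nbhs z)) (cvg_cst q)).
  exact: C.
have cd := cvg_comp _ _ cw (@dcutoff_continuous _ v _).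
have C : (fun y => dblend h q r y v) @ z --> dblend h q r z v.
  have vJ := cvg_mulmx (cvg_cst v) Ch.2.
  have C1 := cvgZ cc (cvgB (vJ _ _) (cvg_cst (v *m Jac h q))).
  have C2 := cvgZ (cvgM (cvg_cst (r^-1 : R)) cd) (cvgB ch ct).
  have C3 := cvgD (cvg_cst (v *m Jac h q)) (cvgD (C1 _ _ _ _ _) (C2 _ _ _ _)).
  exact: C3.
rewrite /prop_for /continuous_at -(nbhs_singleton E).
exact: cvg_trans (near_eq_cvg E) C.
Qed.

Lemma tangent_model_approx h q e : differentiable h q -> 0 < e ->
  \forall z \near q, `|h z - tangent_model h q z| <= e * `|z - q|.
Proof.
move=> /diff_locallyP[_ /eqaddoP/(_ _) dh] e0.
rewrite (near_shift 0 q) subr0; apply: filterS (dh e e0) => v.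
rewrite /shift /= /tangent_model addrK !fctE /= (diffE_Jac h q v).
by rewrite [`|id v|]/=.
Qed.

(** On the ball of radius [2 * r] the derivative of the cutoff is of order
[1 / r], while it multiplies an error of order [e * r]: the product is small with
[e].  The factor 65 is 1 for the variation of the Jacobian of [h], plus
[32 * 2] from [dcutoff_bound] and the radius [2 * r]. *)
Lemma blend_Jac_approx h q (r e : R) z : 0 < r -> 0 < e ->
  differentiable h z -> `|z - q| <= 2 * r ->
  `|h z - tangent_model h q z| <= e * `|z - q| -> `|Jac h z - Jac h q| <= e ->
  `|Jac (blend h q r) z - Jac h q| <= 65 * e.
Proof.
move=> r0 e0 dh zr he Je; apply: norm_mx_le => [|i j]; first by lra.
have db := is_diff_blend q r dh.
pose v : 'rV[R]_2 := delta_mx 0 i.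
have v1 : `|v| <= 1.
  by apply: norm_mx_le => // k l; rewrite mxE; case: andP; rewrite ?normr1 ?normr0.
have -> : (Jac (blend h q r) z - Jac h q) i j =
    (dblend h q r z v - v *m Jac h q) 0 j.
  have <- : v *m Jac (blend h q r) z = dblend h q r z v.
    by rewrite -(diffE_Jac (blend h q r) z v) diff_val.
  by rewrite -!rowE !mxE.
set w := r^-1 *: (z - q).
have w2 : `|w| <= 2.
  by rewrite /w normrZ gtr0_norm ?invr_gt0// ler_pdivrMl// mulrC.
have -> : (dblend h q r z v - v *m Jac h q) 0 j =
    cutoff w * (Jac h z - Jac h q) i j +
    r^-1 * dcutoff w v * (h z - tangent_model h q z) 0 j.
  by rewrite /dblend -!rowE -/w !mxE; ring.
have H1 : `|cutoff w * (Jac h z - Jac h q) i j| <= e.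
  rewrite normrM -[leRHS]mul1r; apply: ler_pM => //.
    by rewrite ger0_norm ?cutoff_ge0 ?cutoff_le1.
  exact: le_trans (coord_le_norm _ _ _) Je.
have H2 : `|r^-1 * dcutoff w v * (h z - tangent_model h q z) 0 j| <= 64 * e.
  have -> : 64 * e = r^-1 * 32 * (e * (2 * r)) by field; rewrite gt_eqF.
  rewrite normrM; apply: ler_pM => //.
    rewrite normrM gtr0_norm ?invr_gt0// ler_pM2l ?invr_gt0//.
    by have := dcutoff_bound v w2; lra.
  apply: le_trans (coord_le_norm _ _ _) (le_trans he _).
  by rewrite ler_pM2l.
by apply: le_trans (ler_normD _ _) _; lra.
Qed.

(** As [r] tends to 0, the 1-jets of the blended maps over the ball of radius
[2 * r] tend to the 1-jet of [h] at the centre. *)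
Lemma blend_cvg h q e : C1_near h q -> 0 < e ->
  \forall r \near 0^'+, forall z, `|z - q| <= 2 * r ->
    [/\ differentiable h z, `|blend h q r z - h q| < e &
        `|Jac (blend h q r) z - Jac h q| < e].
Proof.
(* 66 = 65 + 1 turns the bound of blend_Jac_approx into a strict one. *)
move=> Ch e0; pose d := e / 66.
have d0 : 0 < d by rewrite divr_gt0.
have eE : e = 66 * d by rewrite /d; field.
have dh := C1_near_differentiable Ch.
have tq : tangent_model h q q = h q by rewrite /tangent_model subrr mul0mx addr0.
have N1 : \forall z \near q, `|tangent_model h q z - h q| < e / 2.
  have := is_diff_continuous (is_diff_tangent_model h q q); rewrite tq => C.
  have e2 : 0 < e / 2 by rewrite divr_gt0.
  have N := (cvgrPdist_lt _ _).1 C _ e2.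
  by near=> z; rewrite distrC; near: z; exact: N.
have N2 : \forall z \near q, `|Jac h z - Jac h q| <= d.
  have N := (cvgrPdist_le _ _).1 Ch.2 _ d0.
  by near=> z; rewrite distrC; near: z; exact: N.
have N3 := tangent_model_approx dh d0.
have N := filterI (filterI N1 N2) (filterI N3 Ch.1).
have [s /= s0 sN] := (nbhs_normP _ _).1 (N _ _ _).
near=> r.
have r0 : 0 < r by near: r; exact: nbhs_right_gt.
have rs : r < s / 2 by near: r; apply: nbhs_right_lt; rewrite divr_gt0.
have r1 : r < 1 by near: r; exact: nbhs_right_lt.
move=> z zr.
have zs : `|q - z| < s by rewrite distrC; apply: le_lt_trans zr _; lra.
have [[z1 z2] [z3 z4]] := sN z zs; split=> //.
  have hE : blend h q r z - h q = tangent_model h q z - h q +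
      cutoff (r^-1 *: (z - q)) *: (h z - tangent_model h q z).
    by rewrite /blend addrAC.
  have c1 : `|cutoff (r^-1 *: (z - q)) *: (h z - tangent_model h q z)| <=
      d * `|z - q|.
    rewrite normrZ ger0_norm ?cutoff_ge0// -[leRHS]mul1r.
    by apply: ler_pM => //; [exact: cutoff_ge0|exact: cutoff_le1].
  have c2 : d * `|z - q| <= d * 2 by rewrite ler_pM2l//; lra.
  rewrite hE; apply: le_lt_trans (ler_normD _ _) _.
  by lra.
apply: le_lt_trans (blend_Jac_approx r0 d0 z4 zr z3 z2) _.
by lra.
Unshelve. all: by end_near. Qed.

End Blend.

(** * Local regularity read in charts *)

Section Charts.
Context {R : realType} {M : closedSurface R}.
Implicit Types (c d : chart R M) (f g : M -> M) (x y : M).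

Lemma near_chart c y : chart_dom c y -> \forall x \near y, chart_dom c x.
Proof. by move=> cy; exact: open_nbhs_nbhs (conj (chart_dom_open c) cy). Qed.

Lemma near_chart_img c y : chart_dom c y ->
  \forall z \near c y, (c @` chart_dom c) z.
Proof.
move=> cy; apply: open_nbhs_nbhs; split; first exact: chart_img_open.
by exists y.
Qed.

Lemma chart_inv_cvg c y : chart_dom c y -> chart_inv c @ (c y) --> y.
Proof.
move=> cy; have C : {for c y, continuous (chart_inv c)}.
  by apply: chart_inv_continuous; exists y.
by move: C; rewrite /prop_for /continuous_at chart_mapK.
Qed.

Lemma chart_cvg c y : chart_dom c y -> c @ y --> c y.
Proof. by move=> /(chart_map_continuous (c := c)). Qed.

Lemma open_chart_image c (O : set M) : open O -> open (c @` (chart_dom c `&` O)).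
Proof.
move=> oO; rewrite openE => _ [y [cy Oy] <-].
have N1 : \forall z \near c y, O (chart_inv c z).
  exact: chart_inv_cvg cy _ (open_nbhs_nbhs (conj oO Oy)).
apply: filterS2 (near_chart_img cy) N1 => z [x cx <-].
by rewrite chart_mapK // => Ox; exists x.
Qed.

Lemma transition_C1 c d y : surface_atlas c -> surface_atlas d ->
  chart_dom c y -> chart_dom d y -> C1_near (d \o chart_inv c) (c y).
Proof.
move=> ac ad cy dy.
have [+ _] := Ck_on1P (d \o chart_inv c)
  (open_chart_image (c := c) (chart_dom_open d)).
by apply; [exact: (transition_smooth ac ad 1)|exists y].
Qed.

Definition C1_at f y := f @ y --> f y /\
  forall c d, surface_atlas c -> surface_atlas d ->
    chart_dom c y -> chart_dom d (f y) -> C1_near (local_rep c d f) (c y).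

Lemma C1_mapP f : C1_map f <-> forall y, C1_at f y.
Proof.
split=> [[cf Cf] y|Cf].
  split=> [|c d ac ad cy dfy]; first exact: cf.
  have oO : open (f @^-1` chart_dom d).
    by apply: open_comp (chart_dom_open d) => x _; exact: cf.
  have [+ _] := Ck_on1P (local_rep c d f) (open_chart_image (c := c) oO).
  by apply; [exact: Cf|exists y].
have cf : continuous f by move=> y; case: (Cf y).
split=> // c d ac ad.
have oO : open (f @^-1` chart_dom d).
  by apply: open_comp (chart_dom_open d) => x _; exact: cf.
apply/(Ck_on1P _ (open_chart_image (c := c) oO)) => _ [y [cy dfy] <-].
by have [_] := Cf y; exact.
Qed.

Lemma End1_C1_at (f : End1 M) y : C1_at f y.
Proof. by have /C1_mapP := end_C1 f; exact. Qed.

Lemma near_eq_local_rep c d f g y : chart_dom c y -> {near y, f =1 g} ->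
  {near c y, local_rep c d f =1 local_rep c d g}.
Proof.
move=> cy fg; have N : \forall z \near c y, f (chart_inv c z) = g (chart_inv c z).
  exact: chart_inv_cvg cy _ fg.
by apply: filterS N => z fgz; rewrite /local_rep /= fgz.
Qed.

Lemma near_eq_C1_at f g y : {near y, f =1 g} -> C1_at f y -> C1_at g y.
Proof.
move=> fg [cf Cf]; have fgy : f y = g y := nbhs_singleton fg; split.
  by rewrite -fgy; exact: cvg_trans (near_eq_cvg fg) cf.
move=> c d ac ad cy; rewrite -fgy => dfy.
exact: near_eq_C1_near (near_eq_local_rep d cy fg) (Cf c d ac ad cy dfy).
Qed.

End Charts.

Section ChartFactorization.
Context {R : realType} {M : closedSurface R}.
Context (c0 d0 : chart R M) (g : M -> M) (h : 'rV[R]_2 -> 'rV[R]_2) (y : M).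
Context (ac0 : surface_atlas c0) (ad0 : surface_atlas d0).
Context (c0y : chart_dom c0 y) (hy : (d0 @` chart_dom d0) (h (c0 y))).
Context (gE : {near y, g =1 chart_inv d0 \o h \o c0}).
Context (Ch : C1_near h (c0 y)).

Let hgy : chart_dom d0 (g y) /\ d0 (g y) = h (c0 y).
Proof. by rewrite (nbhs_singleton gE) /=; case: hy => x dx <-; rewrite chart_mapK. Qed.

Lemma local_rep_factor (c d : chart R M) : chart_dom c y ->
  {near c y, (d \o chart_inv d0) \o (h \o (c0 \o chart_inv c))
     =1 local_rep c d g}.
Proof.
move=> cy; have N : \forall z \near c y, g (chart_inv c z) =
    (chart_inv d0 \o h \o c0) (chart_inv c z).
  exact: chart_inv_cvg cy _ gE.
by apply: filterS N => z gz; rewrite /local_rep /= gz.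
Qed.

(** A map that is given near [y] by a planar map [h] in one pair of charts is
given in any other pair by [h] composed with transition maps; so its regularity
and its Jacobian are those of [h] up to transition maps. *)
Lemma C1_near_factor (c d : chart R M) : surface_atlas c -> surface_atlas d ->
  chart_dom c y -> chart_dom d (g y) ->
  C1_near (local_rep c d g) (c y) /\
  Jac (local_rep c d g) (c y) =
    Jac (c0 \o chart_inv c) (c y) *m Jac h (c0 y) *m
    Jac (d \o chart_inv d0) (h (c0 y)).
Proof.
move=> ac ad cy dgy; have E := local_rep_factor d cy.
have CS := transition_C1 ac ac0 cy c0y.
have SE : (c0 \o chart_inv c) (c y) = c0 y by rewrite /= chart_mapK.
have CT : C1_near (d \o chart_inv d0) (h (c0 y)).
  by have [d0gy <-] := hgy; exact: transition_C1.
have Ch' : C1_near h ((c0 \o chart_inv c) (c y)) by rewrite SE.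
have ChS := C1_near_comp CS Ch'.
have CT' : C1_near (d \o chart_inv d0) ((h \o (c0 \o chart_inv c)) (c y)).
  by rewrite [X in C1_near _ X]/= chart_mapK.
have CC := C1_near_comp ChS CT'.
split; first exact: near_eq_C1_near E CC.
rewrite (near_eq_Jac E (C1_near_differentiable CC)).
rewrite (Jac_comp (C1_near_differentiable ChS) (C1_near_differentiable CT')).
rewrite (Jac_comp (C1_near_differentiable CS) (C1_near_differentiable Ch')).
by rewrite -[(h \o _) _]/(h ((c0 \o chart_inv c) (c y))) SE.
Qed.

Lemma C1_at_factor : C1_at g y.
Proof.
have [d0gy hgE] := hgy.
split=> [|c d ac ad cy dgy]; last by case: (C1_near_factor ac ad cy dgy).
have C1 : h \o c0 @ y --> h (c0 y).
  exact: (cvg_comp _ _ (chart_cvg c0y) (C1_near_continuous Ch)).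
have C2 : chart_inv d0 @ (h (c0 y)) --> g y by rewrite -hgE; exact: chart_inv_cvg.
have C3 := cvg_comp _ _ C1 C2.
have E : {near y, chart_inv d0 \o (h \o c0) =1 g}.
  by apply: filterS gE => x ->.
exact: cvg_trans (near_eq_cvg E) C3.
Qed.

End ChartFactorization.

(** * Making an endomorphism affine near a point *)

Section Flatten.
Context {R : realType} {M : closedSurface R}.
Context (f : End1 M) (p : M).

Local Notation c0 := (chart_at p).
Local Notation d0 := (chart_at (f p)).
Local Notation q := (chart_at p p).
Local Notation h := (local_rep c0 d0 f).

Let C1h y : chart_dom c0 y -> chart_dom d0 (f y) -> C1_near h (c0 y).
Proof.
have [_ Cf] := End1_C1_at f y; exact: Cf (chart_at_atlas p) (chart_at_atlas (f p)).
Qed.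

Let hq : h q = d0 (f p).
Proof. by rewrite /local_rep /= chart_mapK//; exact: chart_at_dom. Qed.

Definition chart_disc (r : R) : set M :=
  [set y | chart_dom c0 y /\ `|c0 y - q| <= 2 * r].

Definition flatten (r : R) (y : M) : M :=
  if `[< chart_disc r y >] then chart_inv d0 (blend h q r (c0 y)) else f y.

(** Margins that let [flatten r] be a C1 map: the ball of radius [3 * r], on
which [f] is read in the preferred charts, leaves room around the disc of radius
[2 * r], where [f] is modified, to glue the two formulas. *)
Definition good_radius (r : R) := 0 < r /\
  forall z, `|z - q| < 3 * r ->
    (exists y, [/\ chart_dom c0 y, chart_dom d0 (f y) & c0 y = z]) /\
    (d0 @` chart_dom d0) (blend h q r z).

Lemma near_good_radius : \forall r \near 0^'+, good_radius r.
Proof.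
have cp := chart_at_dom p; have dp := chart_at_dom (f p).
have oO : open (f @^-1` chart_dom d0).
  by apply: open_comp (chart_dom_open d0) => x _; case: (End1_C1_at f x).
have N : \forall z \near q, (c0 @` (chart_dom c0 `&` f @^-1` chart_dom d0)) z.
  apply: open_nbhs_nbhs; split; first exact: open_chart_image.
  by exists p.
have [s /= s0 sN] := (nbhs_normP _ _).1 N.
have [e /= e0 eN] := (nbhs_normP _ _).1 (near_chart_img dp).
have Ch : C1_near h q by exact: C1h.
have B := blend_cvg Ch e0.
near=> r.
have r0 : 0 < r by near: r; exact: nbhs_right_gt.
have rs : r < s / 3 by near: r; apply: nbhs_right_lt; rewrite divr_gt0.
split=> // z zr; have zs : `|q - z| < s by rewrite distrC; lra.
have [y [cy dfy] yz] := sN z zs; split; first by exists y.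
have [zr2|zr2] := leP `|z - q| (2 * r).
  have Br : forall z, `|z - q| <= 2 * r -> [/\ differentiable h z,
      `|blend h q r z - h q| < e & `|Jac (blend h q r) z - Jac h q| < e].
    by near: r; exact: B.
  have [_ Bz _] := Br z zr2.
  by apply: eN; rewrite /= -hq distrC.
rewrite blend_out //; last exact: ltW.
by exists (f y) => //; rewrite -yz /local_rep /= chart_mapK.
Unshelve. all: by end_near. Qed.

Lemma chart_discE (r : R) : good_radius r ->
  chart_disc r = chart_inv c0 @` [set z | `|z - q| <= 2 * r].
Proof.
move=> [r0 gr]; rewrite eqEsubset; split=> [y [cy yr]|_ [z /= zr <-]].
  by exists (c0 y) => //; exact: chart_mapK.
have /gr[[y [cy _ yz]] _] : `|z - q| < 3 * r by lra.
by rewrite -yz chart_mapK //; split=> //; rewrite yz.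
Qed.

(** The disc is compact, hence closed in the Hausdorff space [M]; closedness in
[M], and not only in the chart domain, is what makes [flatten] agree with [f] near
every point outside the disc. *)
Lemma closed_chart_disc (r : R) : good_radius r -> closed (chart_disc r).
Proof.
move=> gr; apply: compact_closed; first exact: surface_hausdorff.
rewrite chart_discE//; apply: continuous_compact.
  apply: continuous_in_subspaceT => z; rewrite inE /= => zr.
  have [r0 /(_ z)[|[y [cy _ yz]] _]] := gr; first by lra.
  by apply: chart_inv_continuous; exists y.
apply: bounded_closed_compact.
  exists (`|q| + 2 * r); split; first exact: num_real.
  move=> x xr z /= zr; apply: le_trans (ltW xr).
  by rewrite -[z](subrK q) addrC; apply: le_trans (ler_normD _ _) _; lra.
have -> : [set z | `|z - q| <= 2 * r] =
    (fun z => `|z - q|) @^-1` [set x | x <= 2 * r] by [].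
apply: closed_comp; last exact: closed_le.
move=> z _; have C := cvg_norm (cvgB (@cvg_id _ (nbhs z)) (cvg_cst q)); exact: C.
Qed.

(** Between the radii [2 * r] and [3 * r] both formulas defining [flatten] give
[f], so the planar formula holds on an open set containing the disc. *)
Lemma flatten_factor (r : R) y : good_radius r -> chart_dom c0 y ->
  `|c0 y - q| < 3 * r ->
  {near y, flatten r =1 chart_inv d0 \o blend h q r \o c0}.
Proof.
move=> [r0 gr] cy yr.
have N : \forall x \near y, `|c0 x - q| < 3 * r.
  have C := cvg_norm (cvgB (chart_cvg cy) (cvg_cst q)).
  exact: cvgr_lt (C _ _ _) _ yr.
apply: filterS2 (near_chart cy) N => x cx xr.
rewrite /flatten; case: asboolP => // xnr /=.
rewrite blend_out ?/local_rep//=; last first.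
  by rewrite leNgt; apply/negP => xr2; apply: xnr; split=> //; exact: ltW.
have [[x' [cx' dfx' xE]] _] := gr _ xr.
have -> : x = x' by rewrite -(chart_mapK cx) -xE chart_mapK.
by rewrite !chart_mapK.
Qed.

Lemma flatten_out (r : R) y : good_radius r -> ~ chart_disc r y ->
  {near y, f =1 flatten r}.
Proof.
move=> gr ny; have oD : open (~` chart_disc r).
  by rewrite openC; exact: closed_chart_disc.
apply: filterS (open_nbhs_nbhs (conj oD ny)) => x nx.
by rewrite /flatten; case: asboolP.
Qed.

Lemma C1_at_flatten (r : R) y : good_radius r -> C1_at (flatten r) y.
Proof.
move=> gr; have [[cy yr]|ny] := pselect (chart_disc r y); last first.
  exact: near_eq_C1_at (flatten_out gr ny) (End1_C1_at f y).
have yr3 : `|c0 y - q| < 3 * r by case: gr => r0 _; lra.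
have [[y' [cy' dfy' yE]] iy] := gr.2 _ yr3.
have yy' : y = y' by rewrite -(chart_mapK cy) -yE chart_mapK.
apply: (C1_at_factor (chart_at_atlas p) (chart_at_atlas (f p)) cy iy).
  exact: flatten_factor.
by apply: C1_near_blend; apply: C1h => //; rewrite yy'.
Qed.

Lemma near_disc_subset (V : set M) : nbhs p V ->
  \forall r \near 0^'+, chart_disc r `<=` V.
Proof.
move=> pV; have N : \forall z \near q, V (chart_inv c0 z).
  exact: chart_inv_cvg (chart_at_dom p) _ pV.
have [s /= s0 sN] := (nbhs_normP _ _).1 N.
near=> r => y [cy yr].
have rs : r < s / 2 by near: r; apply: nbhs_right_lt; rewrite divr_gt0.
rewrite -(chart_mapK cy); apply: sN; rewrite /= distrC; lra.
Unshelve. all: by end_near. Qed.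

End Flatten.

(** * Convergence in the C1 topology *)

Section C1Topology.
Context {R : realType} {M : closedSurface R}.

Lemma cvg_C1_subbase (T : Type) (F : set_system T) {FF : Filter F}
    (g : T -> End1 M) (f : End1 M) :
  (forall N, C1_subbase N -> N f -> \forall t \near F, N (g t)) -> g @ F --> f.
Proof.
move=> gN U; rewrite nbhsE => -[B [[D DF DB] Bf] BU].
move: Bf; rewrite -DB => -[A DA Af].
have [E EF EA] := DF _ DA.
have FA : F (g @^-1` A).
  rewrite -EA preimage_bigcap; apply: filter_bigI => N NE.
  apply: gN; first exact/set_mem/(EF N NE).
  by move: Af; rewrite /= -EA => /(_ N NE).
by apply: filterS FA => t At /=; apply: BU; rewrite -DB; exists A.
Qed.

End C1Topology.

Section FlattenCvg.
Context {R : realType} {M : closedSurface R}.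
Context (f : End1 M) (p : M).

Local Notation c0 := (chart_at p).
Local Notation d0 := (chart_at (f p)).
Local Notation q := (chart_at p p).
Local Notation h := (local_rep c0 d0 f).

(** For radii that are not good the value [f] is a mere default; only the limit
as [r] tends to 0 matters. *)
Definition flatten_end (r : R) : End1 M :=
  if pselect (C1_map (flatten f p r)) is left Cr then MkEnd1 Cr else f.

Lemma flatten_endE r : good_radius f p r -> flatten_end r = flatten f p r :> (M -> M).
Proof.
move=> gr; rewrite /flatten_end; case: pselect => // -[].
by apply/C1_mapP => y; exact: C1_at_flatten.
Qed.

(** The condition that membership in a ball of the C1 topology, read in the
charts [c] and [d], imposes on a map whose 1-jet in the preferred charts is
[(z, w, B)]; [k] stands for the centre of the ball. *)
Definition jet_cond (c d : chart R M) (k : 'rV[R]_2 -> 'rV[R]_2) (e : R) z w B :=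
  [/\ chart_dom d (chart_inv d0 w),
      `|(d \o chart_inv d0) w - k ((c \o chart_inv c0) z)| < e &
      `|Jac (c0 \o chart_inv c) ((c \o chart_inv c0) z) *m B *m
         Jac (d \o chart_inv d0) w - Jac k ((c \o chart_inv c0) z)| < e].

(** The condition is continuous in the jet, and at the jet of [f] at [p] it says
that [f] lies in the ball. *)
Lemma jet_cond_open (c d : chart R M) k e : surface_atlas c -> surface_atlas d ->
  chart_dom c p -> chart_dom d (f p) -> C1_near k (c p) ->
  `|local_rep c d f (c p) - k (c p)| < e ->
  `|Jac (local_rep c d f) (c p) - Jac k (c p)| < e ->
  exists2 s : R, 0 < s & forall z w B,
    `|z - q| < s -> `|w - h q| < s -> `|B - Jac h q| < s -> jet_cond c d k e z w B.
Proof.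
move=> ac ad cp dp Ck Ek EJ.
have ac0 := chart_at_atlas p; have ad0 := chart_at_atlas (f p).
have c0p := chart_at_dom p; have d0p := chart_at_dom (f p).
have hq : h q = d0 (f p) by rewrite /local_rep /= chart_mapK.
have Ch : C1_near h q by case: (End1_C1_at f p) => _ Cf; exact: Cf.
have fE : {near p, (f : M -> M) =1 chart_inv d0 \o h \o c0}.
  have N : \forall y \near p, chart_dom d0 (f y).
    by have [cf _] := End1_C1_at f p; exact: cf _ (near_chart d0p).
  apply: filterS2 (near_chart c0p) N => y cy dy.
  by rewrite /local_rep /= !chart_mapK.
have hi : (d0 @` chart_dom d0) (h q) by rewrite hq; exists (f p).
have [_ JE] := C1_near_factor ac0 ad0 c0p hi fE Ch ac ad cp dp.
pose S' := c \o chart_inv c0; pose S := c0 \o chart_inv c.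
pose T := d \o chart_inv d0.
have S'q : S' q = c p by rewrite /S' /= chart_mapK.
have Thq : T (h q) = local_rep c d f (c p).
  by rewrite hq /T /local_rep /= !chart_mapK.
have CS' : C1_near S' q := transition_C1 ac0 ac c0p cp.
have CS : C1_near S (S' q) by rewrite S'q; exact: transition_C1.
have CT : C1_near T (h q) by rewrite hq; exact: transition_C1.
have Ck' : C1_near k (S' q) by rewrite S'q.
pose t0 : 'rV[R]_2 * 'rV[R]_2 * 'M[R]_2 := (q, h q, Jac h q).
have z_ : (fun t : 'rV[R]_2 * 'rV[R]_2 * 'M[R]_2 => t.1.1) @ t0 --> q.
  by have C := cvg_comp _ _ (@cvg_fst _ _ (nbhs t0.1) (nbhs t0.2) _) (@cvg_fst _ _ (nbhs t0.1.1) (nbhs t0.1.2) _); exact: C.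
have w_ : (fun t : 'rV[R]_2 * 'rV[R]_2 * 'M[R]_2 => t.1.2) @ t0 --> h q.
  by have C := cvg_comp _ _ (@cvg_fst _ _ (nbhs t0.1) (nbhs t0.2) _) (@cvg_snd _ _ (nbhs t0.1.1) (nbhs t0.1.2) _); exact: C.
have B_ : (fun t : 'rV[R]_2 * 'rV[R]_2 * 'M[R]_2 => t.2) @ t0 --> Jac h q.
  by have C := @cvg_snd _ _ (nbhs t0.1) (nbhs t0.2) _; exact: C.
have S'_ := cvg_comp _ _ z_ (C1_near_continuous CS').
have Tw_ := cvg_comp _ _ w_ (C1_near_continuous CT).
have k_ := cvg_comp _ _ S'_ (C1_near_continuous Ck').
have JS_ := cvg_comp _ _ S'_ CS.2.
have JT_ := cvg_comp _ _ w_ CT.2.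
have Jk_ := cvg_comp _ _ S'_ Ck'.2.
have V_ := cvg_norm (cvgB Tw_ k_).
have J_ := cvg_norm (cvgB (cvg_mulmx (cvg_mulmx JS_ B_) JT_) Jk_).
have N1 : \forall t \near t0, chart_dom d (chart_inv d0 t.1.2).
  have C : chart_inv d0 @ h q --> f p by rewrite hq; exact: chart_inv_cvg.
  exact: cvg_comp _ _ w_ C _ (near_chart dp).
have N2 : \forall t \near t0, `|T t.1.2 - k (S' t.1.1)| < e.
  have E2 : `|T (h q) - k (S' q)| < e by rewrite S'q Thq.
  exact: cvgr_lt (V_ _ _) _ E2.
have N3 : \forall t \near t0,
    `|Jac S (S' t.1.1) *m t.2 *m Jac T t.1.2 - Jac k (S' t.1.1)| < e.
  have E3 : `|Jac S (S' q) *m Jac h q *m Jac T (h q) - Jac k (S' q)| < e.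
    by rewrite S'q -JE.
  exact: cvgr_lt (J_ _ _ _ _) _ E3.
have N := filterI N1 (filterI N2 N3).
have [s /= s0 sN] := (nbhs_ballP _ _).1 (N _ _).
exists s => // z w B zs ws Bs.
have [|/= ? [? ?]] := sN (z, w, B); last by split.
by rewrite /t0; split; [split|]; rewrite -ball_normE /= distrC.
Qed.

Lemma C1_ballP (g g' : End1 M) c d K e : C1_ball g c d K e g' <->
  forall x, K x -> [/\ chart_dom d (g' x),
    `|local_rep c d g' (c x) - local_rep c d g (c x)| < e &
    `|Jac (local_rep c d g') (c x) - Jac (local_rep c d g) (c x)| < e].
Proof.
rewrite Jac.unlock; split=> [[Kd KC] x Kx|H].
  by have [? ?] := KC x Kx; split=> //; apply: Kd; exists x.
split=> [_ [x Kx <-]|x Kx]; first by have [] := H x Kx.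
by have [] := H x Kx.
Qed.

(** The discs shrink to [p], so only the behaviour at [p] decides.  If [p] is
not in [K] the disc avoids [K].  If it is, the jets of [flatten_end r] over the disc
are close to the jet of [f] at [p], where the strict inequalities defining the ball
hold. *)
Lemma near_flatten_ball (g : End1 M) (c d : chart R M) (K : set M) (e : R) :
  surface_atlas c -> surface_atlas d -> compact K -> K `<=` chart_dom c ->
  g @` K `<=` chart_dom d -> C1_ball g c d K e f ->
  \forall r \near 0^'+, C1_ball g c d K e (flatten_end r).
Proof.
move=> ac ad coK Kc gK /C1_ballP fK.
have out r x : good_radius f p r -> ~ chart_disc p r x -> K x ->
    [/\ chart_dom d (flatten_end r x),
    `|local_rep c d (flatten_end r) (c x) - local_rep c d g (c x)| < e &
    `|Jac (local_rep c d (flatten_end r)) (c x) - Jac (local_rep c d g) (c x)| < e].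
  move=> gr nx Kx; rewrite flatten_endE //; have E := flatten_out gr nx.
  have [dfx Vx Jx] := fK x Kx; have cx := Kc x Kx.
  have E' := near_eq_local_rep d cx E.
  have Cf : C1_near (local_rep c d f) (c x) by have [_] := End1_C1_at f x; exact.
  rewrite -(nbhs_singleton E) -(nbhs_singleton E').
  by rewrite (near_eq_Jac E' (C1_near_differentiable Cf)).
have [Kp|nKp] := pselect (K p); last first.
  have pK : nbhs p (~` K).
    apply: open_nbhs_nbhs; split=> //; rewrite openC.
    by apply: compact_closed coK; exact: surface_hausdorff.
  apply: filterS2 (near_good_radius f p) (near_disc_subset pK) => r gr rK.
  by apply/C1_ballP => x Kx; apply: out => // /rK.
have [dfp Vp Jp] := fK p Kp; have cp := Kc p Kp.
have dgp : chart_dom d (g p) by apply: gK; exists p.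
have Cg : C1_near (local_rep c d g) (c p).
  by have /C1_mapP/(_ p)[_] := end_C1 g; exact.
have [s s0 sP] := jet_cond_open ac ad cp dfp Cg Vp Jp.
have Ch : C1_near h q.
  have [_ Cf] := End1_C1_at f p.
  by apply: Cf; [exact: chart_at_atlas|exact: chart_at_atlas|exact: chart_at_dom|exact: chart_at_dom].
have pc := near_disc_subset (near_chart cp).
near=> r; apply/C1_ballP => x Kx.
have gr : good_radius f p r by near: r; exact: near_good_radius.
have rs : r < s / 2 by near: r; apply: nbhs_right_lt; rewrite divr_gt0.
have B : forall z, `|z - q| <= 2 * r -> [/\ differentiable h z,
    `|blend h q r z - h q| < s & `|Jac (blend h q r) z - Jac h q| < s].
  by near: r; exact: blend_cvg.
(* Outside the disc nothing has changed; inside, the jet at x is close to that at p. *)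
have [[c0x xr]|nx] := pselect (chart_disc p r x); last exact: out.
have cx := Kc x Kx; have [dx Bx Jx] := B _ xr.
have xs : `|c0 x - q| < s by apply: le_lt_trans xr _; lra.
have [jd jv jJ] := sP _ _ _ xs Bx Jx.
have xr3 : `|c0 x - q| < 3 * r by case: gr => r0 _; lra.
have [[y [c0y d0fy yE]] iy] := gr.2 _ xr3.
have yx : y = x by rewrite -(chart_mapK c0x) -yE chart_mapK.
have Chx : C1_near h (c0 x).
  rewrite -yx; have [_ Cf] := End1_C1_at f y.
  by apply: Cf => //; exact: chart_at_atlas.
have FE := flatten_factor gr c0x xr3.
rewrite flatten_endE //.
have fx : flatten f p r x = chart_inv d0 (blend h q r (c0 x)).
  exact: nbhs_singleton FE.
have dFx : chart_dom d (flatten f p r x) by rewrite fx.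
have [_ JE] := C1_near_factor (chart_at_atlas p) (chart_at_atlas (f p)) c0x iy
  FE (C1_near_blend q r Chx) ac ad cx dFx.
have xE : (c \o chart_inv c0) (c0 x) = c x by rewrite /= chart_mapK.
rewrite xE in jv jJ; split=> //; last by rewrite JE.
by rewrite [X in `|X - _|](_ : _ = (d \o chart_inv d0) (blend h q r (c0 x)))//
  /local_rep /= chart_mapK// fx.
Unshelve. all: by end_near. Qed.

Lemma flatten_end_cvg : flatten_end @ 0^'+ --> f.
Proof.
apply: cvg_C1_subbase => N [g [c [d [K [e [[ac ad] [coK Kc] gK e0 ->]]]]]] Nf.
exact: near_flatten_ball.
Qed.

End FlattenCvg.

(** * Linearization along a finite set of points *)

Section Linearization.
Context {R : realType} {M : closedSurface R}.
Implicit Types (f g : End1 M) (p x y : M) (ps qs : seq M).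

Local Notation loc f p := (local_rep (chart_at p) (chart_at (f p)) f).

Definition affine_near (f g : M -> M) p := \forall y \near p,
  chart_dom (chart_at (f p)) (g y) /\
  chart_at (f p) (g y) = tangent_model (loc f p) (chart_at p p) (chart_at p y).

Lemma local_linearization f p (U : set (End1 M)) (V : set M) :
  nbhs f U -> nbhs p V ->
  exists g, [/\ U g, affine_near f g p & forall y, ~ V y -> f y = g y].
Proof.
move=> fU pV.
have N1 : \forall r \near 0^'+, U (flatten_end f p r) by exact: flatten_end_cvg fU.
have N2 := near_good_radius f p; have N3 := near_disc_subset pV.
near (0 : R)^'+ => r.
have Ur : U (flatten_end f p r) by near: r; exact: N1.
have gr : good_radius f p r by near: r; exact: N2.
have rV : chart_disc p r `<=` V by near: r; exact: N3.
exists (flatten_end f p r); split=> //; rewrite flatten_endE//; last first.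
  by move=> y Vy; rewrite /flatten; case: asboolP => // /rV.
have [r0 grz] := gr; have cp := chart_at_dom p.
have N : \forall y \near p, `|chart_at p y - chart_at p p| < r.
  have C := cvg_norm (cvgB (chart_cvg cp) (cvg_cst (chart_at p p))).
  by apply: cvgr_lt (C _ _ _) _ _; rewrite subrr normr0.
apply: filterS2 (near_chart cp) N => y cy yr.
have yr2 : chart_disc p r y by split=> //; lra.
have [_] := grz (chart_at p y) ltac:(lra).
rewrite blend_in//; last exact: ltW.
rewrite /flatten; case: asboolP => // _ [x dx xE].
by rewrite blend_in ?(ltW yr)// -xE chart_mapK.
Unshelve. all: by end_near. Qed.

Lemma separate_seq p ps : p \notin ps ->
  exists2 V : set M, nbhs p V & forall x, x \in ps -> nbhs x (~` V).
Proof.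
elim: ps => [_|a ps IH]; first by exists setT => //; exact: filterT.
rewrite inE negb_or => /andP[pa /IH[V pV Vps]].
have := @surface_hausdorff _ M; rewrite open_hausdorff => /(_ _ _ pa).
move=> [[A B] /= [pA aB] [oA oB AB0]].
exists (V `&` A).
  by apply: filterI => //; apply: open_nbhs_nbhs; split=> //; exact/set_mem.
move=> x; rewrite inE => /orP[/eqP ->|/Vps]; last by apply: filterS => y Vy [].
have N : nbhs a B by apply: open_nbhs_nbhs; split=> //; exact/set_mem.
by apply: filterS N => y By [_ Ay]; have : (A `&` B) y by []; rewrite (eqP AB0).
Qed.

(** The points [qs] still to be treated keep an unmodified neighbourhood, so that
the value and the derivative of the perturbed map there remain those of [f]. *)
Lemma linearize_along f (U : set (End1 M)) ps qs : open U -> U f ->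
  uniq (ps ++ qs) -> exists g, [/\ U g,
    forall p, p \in ps -> affine_near f g p &
    forall p, p \in qs -> {near p, (f : M -> M) =1 g}].
Proof.
move=> oU Uf; elim: ps qs => [|p ps IH] qs.
  by move=> _; exists f; split=> // p _; exact: nearW.
move=> /= /andP[pN uN].
have uN' : uniq (ps ++ p :: qs) by rewrite -cat1s uniq_catCA /= pN.
have [g1 [Ug1 ag1 fg1]] := IH (p :: qs) uN'.
have [V pV Vps] := separate_seq pN.
have [g [Ug ag gV]] := local_linearization (open_nbhs_nbhs (conj oU Ug1)) pV.
have gg1 x : x \in ps ++ qs -> {near x, (g1 : M -> M) =1 g}.
  by move=> /Vps; apply: filterS => y; exact: gV.
exists g; split=> // x; last first.
  move=> xq; have N1 := gg1 x; rewrite mem_cat xq orbT in N1.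
  have N2 := fg1 x; rewrite inE xq orbT in N2.
  by apply: filterS2 (N1 isT) (N2 isT) => y -> ->.
rewrite inE => /orP[/eqP ->|xp]; last first.
  have N1 := gg1 x; rewrite mem_cat xp in N1.
  by apply: filterS2 (N1 isT) (ag1 x xp) => y ->.
have N := fg1 p (mem_head _ _); have fp : f p = g1 p := nbhs_singleton N.
have cp := chart_at_dom p.
move: ag; rewrite /affine_near -fp.
have E := near_eq_local_rep (chart_at (f p)) cp N.
have Cf : C1_near (loc f p) (chart_at p p).
  have [_] := End1_C1_at f p.
  by apply => //; [exact: chart_at_atlas|exact: chart_at_atlas|exact: chart_at_dom].
suff -> : tangent_model (local_rep (chart_at p) (chart_at (f p)) g1) (chart_at p p)
  = tangent_model (loc f p) (chart_at p p) by [].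
rewrite funeqE => z; rewrite /tangent_model -(nbhs_singleton E).
by rewrite (near_eq_Jac E (C1_near_differentiable Cf)).
Qed.

End Linearization.

(** * Iterating maps that are affine along an orbit *)

Section Iterates.
Context {R : realType} {M : closedSurface R}.
Context (f g : End1 M) (x : M).

Local Notation c k := (chart_at (iter k f x)).
Local Notation rep k := (local_rep (chart_at x) (c k) (iter k f)).
Local Notation step k := (local_rep (c k) (c k.+1) f).

Lemma iter_continuous (k : nat) (e : End1 M) : continuous (iter k e).
Proof.
have ce : continuous e by case: (end_C1 e).
elim: k => [|k IH] y; first exact: cvg_id.
exact: (cvg_comp _ _ (IH y) (ce _)).
Qed.

Lemma C1_near_step k : C1_near (step k) (c k (iter k f x)).
Proof.
have [_] := End1_C1_at f (iter k f x).
by apply => //; [exact: chart_at_atlas|exact: chart_at_atlas|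
  exact: chart_at_dom|exact: (chart_at_dom (iter k.+1 f x))].
Qed.

Lemma rep_at k : rep k (chart_at x x) = c k (iter k f x).
Proof. by rewrite /local_rep /= chart_mapK//; exact: chart_at_dom. Qed.

Lemma repS k :
  {near chart_at x x, step k \o rep k =1 rep k.+1}.
Proof.
have cx := chart_at_dom x.
have N : \forall y \near x, chart_dom (c k) (iter k f y).
  exact: iter_continuous _ (near_chart (chart_at_dom _)).
have N' : \forall z \near chart_at x x,
    chart_dom (c k) (iter k f (chart_inv (chart_at x) z)).
  exact: chart_inv_cvg cx _ N.
by apply: filterS N' => z kz; rewrite /local_rep /= chart_mapK.
Qed.

Lemma C1_near_rep k : C1_near (rep k) (chart_at x x).
Proof.
elim: k => [|k IH].
  exact: (transition_C1 (chart_at_atlas x) (chart_at_atlas x)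
    (chart_at_dom x) (chart_at_dom x)).
apply: near_eq_C1_near (@repS k) _; apply: C1_near_comp => //.
by rewrite rep_at; exact: C1_near_step.
Qed.

Lemma Jac_repS k : Jac (rep k.+1) (chart_at x x) =
  Jac (rep k) (chart_at x x) *m Jac (step k) (c k (iter k f x)).
Proof.
have C1 := C1_near_rep k.
have C2 : C1_near (step k) (rep k (chart_at x x)).
  by rewrite rep_at; exact: C1_near_step.
rewrite (near_eq_Jac (@repS k) (C1_near_differentiable (C1_near_comp C1 C2))).
rewrite (Jac_comp (C1_near_differentiable C1) (C1_near_differentiable C2)).
by rewrite rep_at.
Qed.

(** Even for the zeroth iterate the Jacobian is computed from a germ, as the
representation in the chart is the identity only on the image of the chart. *)
Lemma Jac_rep0 : Jac (rep 0) (chart_at x x) = 1%:M.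
Proof.
have cx := chart_at_dom x.
have E : {near chart_at x x, id =1 rep 0}.
  by apply: filterS (near_chart_img cx) => z [y cy <-]; rewrite /local_rep /= chart_mapK.
have d := is_diff_id (chart_at x x : 'rV[R]_2).
have di : differentiable (@id 'rV[R]_2) (chart_at x x) by exact: ex_diff.
rewrite (near_eq_Jac E di).
apply: rV_mulmx_inj => v; rewrite mulmx1 -(diffE_Jac id _ v).
by rewrite diff_val.
Qed.

(** A composition of affine maps is affine with the product of the linear parts,
and by the chain rule this product is the derivative of the iterate of [f]. *)
Lemma iter_affine (n : nat) :
  (forall k, (k < n)%N -> affine_near f g (iter k f x)) ->
  \forall y \near x, chart_dom (c n) (iter n g y) /\
    c n (iter n g y) = tangent_model (rep n) (chart_at x x) (chart_at x y).
Proof.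
elim: n => [_|k IH afg].
  apply: filterS (near_chart (chart_at_dom x)) => y cy; split=> //.
  by rewrite /tangent_model Jac_rep0 mulmx1 (rep_at 0) /= addrC subrK.
have {}IH := IH (fun i ik => afg i (ltnW ik)).
have gk : iter k g x = iter k f x.
  have [dk ck] := nbhs_singleton IH.
  rewrite -(chart_mapK dk) ck /tangent_model subrr mul0mx addr0 rep_at.
  by rewrite chart_mapK //; exact: chart_at_dom.
have N : \forall y \near x, [set z | chart_dom (c k.+1) (g z) /\
    c k.+1 (g z) = tangent_model (step k) (c k (iter k f x)) (c k z)]
    (iter k g y).
  apply: (@iter_continuous k g x); rewrite gk; exact: afg.
apply: filterS2 IH N => y [dk ck] [dk1 ck1]; split=> //.
rewrite [iter k.+1 g y]/= ck1 /tangent_model ck /tangent_model rep_at.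
by rewrite [_ + _ - _]addrAC subrr add0r Jac_repS mulmxA rep_at /local_rep/= chart_mapK//; exact: chart_at_dom.
Qed.

End Iterates.

(** * An iterate that is constant on an open set *)

Section NotTransitive.
Context {R : realType} {M : closedSurface R}.
Implicit Types (a x z : M) (O : set M).

Lemma not_open_set1 a : ~ open [set a].
Proof.
move=> oa; have ca := chart_at_dom a.
have N1 := chart_inv_cvg ca (open_nbhs_nbhs (conj oa (erefl a))).
have N : \forall z \near chart_at a a, z = chart_at a a.
  by apply: filterS2 (near_chart_img ca) N1 => z [y cy <-] /=; rewrite chart_mapK // => ->.
have [s /= s0 sN] := (nbhs_normP _ _).1 N.
(* A point of the plane at distance s / 2 contradicts the isolation of the image. *)
have : `|chart_at a a - (chart_at a a + const_mx (s / 2))| < s.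
  rewrite opprD addNKr normrN; apply: (@le_lt_trans _ _ (s / 2)); last by lra.
  by apply: norm_mx_le => [|i j]; rewrite ?mxE ?ger0_norm //; lra.
move=> /sN /= /(congr1 (fun A : 'rV[R]_2 => A 0 0)); rewrite !mxE; lra.
Qed.

Lemma open_setD_seq O (s : seq M) : open O -> O !=set0 ->
  open (O `\` [set` s]) /\ O `\` [set` s] !=set0.
Proof.
move=> oO O0; elim: s => [|a s [oOs [y Oy]]].
  have -> : [set` [::]] = set0 :> set M by rewrite -subset0 => y.
  by rewrite setD0.
have E : O `\` [set` a :: s] = (O `\` [set` s]) `\` [set a].
  rewrite eqEsubset; split=> z /=; rewrite inE.
    move=> [Oz /negP]; rewrite negb_or => /andP[/eqP za zs].
    by split=> //; split=> //; exact/negP.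
  by move=> [[Oz zs] za]; split=> // /orP[/eqP|].
have T1 : closed [set a].
  by apply: accessible_closed_set1; exact/hausdorff_accessible/surface_hausdorff.
rewrite E; split; first by rewrite setDE; apply: openI => //; exact: closed_openC.
apply: contrapT => /nonemptyPn E0.
apply: (@not_open_set1 a); suff -> : [set a] = O `\` [set` s] by [].
have sub : O `\` [set` s] `<=` [set a].
  by move=> z Oz; apply: contrapT => za; have : set0 z by rewrite -E0.
rewrite eqEsubset; split=> // _ ->.
by rewrite -(sub _ Oy).
Qed.

(** A dense orbit returns to any nonempty open set at arbitrarily late times, as
deleting finitely many points leaves a nonempty open set.  Two visits to the open set
where [iter n g] is constant make the orbit eventually periodic, hence finite, and
a finite set is not dense in a surface. *)
Lemma const_iter_not_transitive (g : M -> M) (n : nat) x b :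
  (\forall y \near x, iter n g y = b) -> ~ transitive_map g.
Proof.
move=> N [z dz].
pose O := [set y | iter n g y = b]^°.
have oO : open O := open_interior _.
have O0 : O !=set0 by exists x.
have iO i : O (iter i g z) -> iter (n + i) g z = b.
  by move=> /interior_subset; rewrite /= iterD.
have [y [Oi [i _ iE]]] := dz _ O0 oO; rewrite -iE in Oi.
have [oO' O'0] := open_setD_seq (map (fun j => iter j g z) (iota 0 i.+1)) oO O0.
have [w [[Oj nj] [j _ jE]]] := dz _ O'0 oO'; rewrite -jE in Oj nj.
have ij : (i < j)%N.
  rewrite ltnNge; apply/negP => ji; apply: nj; apply/mapP; exists j => //.
  by rewrite mem_iota.
(* The iterates of indices n + i < n + j agree, so the first n + j exhaust the orbit. *)
pose s := map (fun k => iter k g z) (iota 0 (n + j)).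
have sP k : iter k g z \in s.
  elim/ltn_ind: k => k IH; have [kn|kn] := ltnP k (n + j).
    by apply/mapP; exists k => //; rewrite mem_iota.
  rewrite -(subnK kn) iterD iO // -(iO _ Oi) -iterD; apply: IH.
  by rewrite -[ltnRHS](subnK kn) ltn_add2l ltn_add2l.
have [oT T0] : open ([set: M] `\` [set` s]) /\ ([set: M] `\` [set` s]) !=set0.
  by apply: open_setD_seq; [exact: openT|exists x].
have [v [[_ ns] [k _ kE]]] := dz _ T0 oT.
by apply: ns; rewrite -kE /=; exact: sP.
Qed.

End NotTransitive.

(** * Full-dimensional kernels exclude robust transitivity *)

Theorem mainTheorem8 (R : realType) (M : closedSurface R) (f : End1 M) :
  full_dimensional_kernel f -> ~ robustly_transitive f.
Proof.
move=> [n [x [n1 _ ker]]] [U fU Ut].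
have J0 : Jac (local_rep (chart_at x) (chart_at (iter n f x)) (iter n f))
    (chart_at x x) = 0.
  apply: rV_mulmx_inj => v; rewrite mulmx0 -diffE_Jac.
  have kE : lker (linfun (tangent_map (iter n f) x)) = fullv.
    by apply/eqP; rewrite eqEdim subvf dimvf ker.
  have : v \in lker (linfun (tangent_map (iter n f) x)) by rewrite kE memvf.
  by rewrite memv_ker => /eqP <-; rewrite [RHS]lfunE.
have oU := open_interior U; have Uf : (U^°) f by [].
pose ps := undup (map (fun k => iter k f x) (iota 0 n)).
have ups : uniq (ps ++ [::]) by rewrite cats0 undup_uniq.
have [g [Ug ag _]] := linearize_along oU Uf ups.
have afg k : (k < n)%N -> affine_near f g (iter k f x).
  move=> kn; apply: ag; rewrite mem_undup; apply/mapP; exists k => //.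
  by rewrite mem_iota.
apply: (@const_iter_not_transitive _ _ g n x (iter n f x)).
  apply: filterS (iter_affine afg) => y [dy].
  rewrite /tangent_model J0 mulmx0 addr0 rep_at => cy.
  by rewrite -(chart_mapK dy) cy chart_mapK//; exact: chart_at_dom.
by apply: Ut; exact: interior_subset.
Qed.
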